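(* Let $K$ be a field. For every positive integer $k$ there exists a connected finite simple graph $G_k$ such that $\mathrm{reg}(R/J(G_k))-\mathrm{v}(J(G_k))=k$, where $R$ is the polynomial ring over $K$ whose variables are the vertices of $G_k$.
   Context: For a finite simple graph $G$ with vertex set $V(G)=\{x_1,\ldots,x_n\}$, let $R=K[x_1,\ldots,x_n]=\bigoplus_{d\ge 0}R_d$ with the standard grading. A vertex cover of $G$ is a set $C\subseteq V(G)$ meeting every edge; it is minimal if it is minimal under inclusion. For $C\subseteq V(G)$ put $X_C=\prod_{x_i\in C}x_i$. The cover ideal of $G$ is $J(G)=\langle X_C : C \text{ a minimal vertex cover of } G\rangle=\bigcap_{\{x_i,x_j\}\in E(G)}\langle x_i,x_j\rangle$ (a proper ideal when $G$ has at least one edge). For a proper graded ideal $I\subseteq R$, the $\mathrm{v}$-number is $\mathrm{v}(I)=\min\{d\ge 0 : \text{there exist } f\in R_d \text{ and } \mathfrak p\in \mathrm{Ass}(I) \text{ with } I:f=\mathfrak p\}$, where $\mathrm{Ass}(I)$ is the set of associated primes of $I$ (i.e. of $R/I$). $\mathrm{reg}(R/I)=\max\{j-i : \beta_{i,j}(R/I)\ne 0\}$ is the Castelnuovo-Mumford regularity, where $\beta_{i,j}(R/I)$ are the graded Betti numbers of $R/I$ over $R$. *)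

(* Defs.v *)
From mathcomp Require Import all_boot all_order all_algebra.
From mathcomp Require Import mpoly.

Set Implicit Arguments.
Unset Strict Implicit.
Unset Printing Implicit Defensive.

Import GRing.Theory.
Local Open Scope ring_scope.

Section Graphs.
Variable n : nat.
Implicit Types (e : rel 'I_n) (C : {set 'I_n}).

Definition simple_graph e := ssrbool.symmetric e /\ irreflexive e.

Definition connected_graph e := (0 < n)%N /\ forall i j, connect e i j.

Definition vertex_cover e : pred {set 'I_n} :=
  fun C => [forall i, forall j, e i j ==> (i \in C) || (j \in C)].

Definition minimal_vertex_cover e : pred {set 'I_n} := minset (vertex_cover e).

End Graphs.

Section Ideals.
Variables (K : fieldType) (n : nat).
Local Notation R := {mpoly K[n]}.
Implicit Types (I P : R -> Prop) (f g h : R).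

Definition cover_monomial (C : {set 'I_n}) : R := \prod_(i in C) 'X_i.

Definition cover_ideal (e : rel 'I_n) : R -> Prop := fun f =>
  exists a : {set 'I_n} -> R,
    f = \sum_(C | minimal_vertex_cover e C) a C * cover_monomial C.

Definition is_ideal I :=
  [/\ I 0, (forall f g, I f -> I g -> I (f + g)) & (forall f g, I g -> I (f * g))].

Definition is_prime_ideal P :=
  [/\ is_ideal P, ~ P 1 & (forall f g, P (f * g) -> P f \/ P g)].

Definition colon I f : R -> Prop := fun h => I (h * f).

(* The annihilator of the class of g in R/I is the colon ideal I : g. *)
Definition associated_prime I P :=
  is_prime_ideal P /\ exists g, forall h, P h <-> colon I g h.

Definition v_degree I (d : nat) :=
  exists f P, [/\ f \is d.-homog, associated_prime I P &
                  forall h, colon I f h <-> P h].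

Definition is_v_number I (v : nat) :=
  v_degree I v /\ forall d, v_degree I d -> (v <= d)%N.

(* F_i is the direct sum over a < rk i of R(- sh i a), written as row vectors;
   the differential F_(i+1) -> F_i is right multiplication by [diff i], and
   [aug] lifts the images in R/I of the basis vectors of F_0. *)
Record free_complex := FreeComplex {
  rk : nat -> nat;
  sh : forall i, 'I_(rk i) -> nat;
  diff : forall i, 'M[R]_(rk i.+1, rk i);
  aug : 'cV[R]_(rk 0)
}.

(* p is zero or homogeneous of degree t - s, an untruncated difference: only
   p = 0 qualifies when t < s. *)
Definition homog_entry (s t : nat) (p : R) :=
  forall m, m \in msupp p -> (mdeg m + s)%N = t.

Definition is_graded (F : free_complex) :=
  (forall a, homog_entry 0 (sh a) (aug F a 0)) /\
  (forall i a b, homog_entry (sh b) (sh a) (diff F i a b)).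

Definition is_resolution I (F : free_complex) :=
  [/\ exists u : 'rV[R]_(rk F 0), I ((u *m aug F) 0 0 - 1),
      forall u : 'rV[R]_(rk F 0),
        I ((u *m aug F) 0 0) <-> exists w, u = w *m diff F 0
    & forall i (u : 'rV[R]_(rk F i.+1)),
        u *m diff F i = 0 <-> exists w, u = w *m diff F i.+1].

(* All entries lie in the irrelevant ideal (x_1, ..., x_n), that is, have
   constant term zero. *)
Definition is_minimal (F : free_complex) :=
  forall i a b, (diff F i a b)@_0%MM = 0.

Definition minimal_graded_free_resolution I (F : free_complex) :=
  [/\ is_graded F, is_resolution I F & is_minimal F].

(* The graded Betti numbers of R/I; the minimal graded free resolution is
   unique up to isomorphism, so any one of them computes the table. A minimal
   one has no generator in negative degree, whence j : nat. *)
Definition is_betti_table I (beta : nat -> nat -> nat) :=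
  exists F, minimal_graded_free_resolution I F /\
    forall i j, beta i j = #|[set a : 'I_(rk F i) | sh a == j]|.

Definition is_regularity I (r : int) :=
  exists beta, [/\ is_betti_table I beta,
    exists i j, beta i j != 0%N /\ r = j%:Z - i%:Z
  & forall i j, beta i j != 0%N -> j%:Z - i%:Z <= r].

End Ideals.

(* Main.v *)
(* Let G be an edge ab together with k isolated vertices, coned over a vertex
   z, and let c be the product of the k remaining variables. The minimal vertex
   covers are {z, a}, {z, b} and the complement of z, so J = (za, zb, abc), and
   the Hilbert-Burch resolution
     0 -> R(-3) + R(-(k+3)) -> R(-2)^2 + R(-(k+2)) -> R
   gives reg(R/J) = k + 1, whereas v(J) = 1 because J : z = (a, b). *)

Require Import Defs.
From mathcomp Require Import all_boot all_order all_algebra.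
From mathcomp Require Import mpoly.
From mathcomp Require Import zify ring.

Set Implicit Arguments.
Unset Strict Implicit.
Unset Printing Implicit Defensive.

Import GRing.Theory Num.Theory.
Local Open Scope ring_scope.

(** Lets [ring] derive one equation from another: the two differences of sides are compared. *)
Lemma eq_of_sub (V : zmodType) (x y u v : V) : u = v -> x - y = u - v -> x = y.
Proof. by move=> ->; rewrite subrr => /subr0_eq. Qed.

(** * Prime ideals generated by variables, and squarefree monomials *)

Section VariableIdeals.
Variables (K : fieldType) (n : nat).
Local Notation R := {mpoly K[n]}.
Implicit Types (D C : {set 'I_n}) (f g h : R) (i : 'I_n).

(** An endomorphism of [R] whose kernel is the ideal generated by the variables in [D]; membership
    thus becomes an equation in a domain. *)
Definition kill_vars D f : R :=
  f \mPo [tuple (if i \in D then 0 else 'X_i) | i < n].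

Definition var_ideal D f :=
  exists g : 'I_n -> R, f = \sum_(i in D) g i * 'X_i.

Lemma kill_varsM D : {morph kill_vars D : f g / f * g}.
Proof. by move=> f g; rewrite /kill_vars rmorphM. Qed.

Lemma kill_varsX D i : kill_vars D 'X_i = if i \in D then 0 else 'X_i.
Proof. by rewrite /kill_vars comp_mpolyXU -tnth_nth tnth_mktuple. Qed.

Lemma var_idealD D f g : var_ideal D f -> var_ideal D g -> var_ideal D (f + g).
Proof.
move=> [u ->] [v ->]; exists (fun i => u i + v i).
by rewrite -big_split; apply: eq_bigr => i _; rewrite mulrDl.
Qed.

Lemma var_idealMl D f g : var_ideal D g -> var_ideal D (f * g).
Proof.
move=> [v ->]; exists (fun i => f * v i).
by rewrite mulr_sumr; apply: eq_bigr => i _; rewrite mulrA.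
Qed.

Lemma var_ideal0 D : var_ideal D 0.
Proof. by exists (fun=> 0); rewrite big1 // => i _; rewrite mul0r. Qed.

Lemma var_idealX D i : i \in D -> var_ideal D 'X_i.
Proof.
move=> iD; exists (fun j => (j == i)%:R); rewrite (bigD1 i) //= eqxx mul1r.
by rewrite big1 ?addr0 // => j /andP[_ /negPf->]; rewrite mul0r.
Qed.

(** The congruence of [f] with its image modulo [D] holds for variables and is stable under products
    and linear combinations, hence holds for all polynomials. *)
Lemma var_ideal_subkill D f : var_ideal D (f - kill_vars D f).
Proof.
pose Q f := var_ideal D (f - kill_vars D f).
have QM g h : Q g -> Q h -> Q (g * h).
  rewrite /Q kill_varsM => Qg Qh.
  have -> : g * h - kill_vars D g * kill_vars D h
    = h * (g - kill_vars D g) + kill_vars D g * (h - kill_vars D h) by ring.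
  by apply: var_idealD; apply: var_idealMl.
have Q1 : Q 1 by rewrite /Q /kill_vars rmorph1 subrr; exact: var_ideal0.
have QX i : Q 'X_i.
  rewrite /Q kill_varsX; case: ifP => iD.
    by rewrite subr0; exact: var_idealX.
  by rewrite subrr; exact: var_ideal0.
rewrite -/(Q f); elim/mpolyind: f => [|c m f _ _ Qf].
  by rewrite /Q /kill_vars rmorph0 subrr; exact: var_ideal0.
rewrite /Q /kill_vars comp_mpolyD opprD addrACA comp_mpolyZ -scalerBr.
apply: var_idealD => //; rewrite -mul_mpolyC; apply: var_idealMl.
rewrite -/(kill_vars D _) -/(Q _) mpolyXE_id.
elim/big_ind: _ => // i _; elim: (m i) => [|j IHj]; first by rewrite expr0.
by rewrite exprS; apply: QM.
Qed.

Lemma var_idealP D f : var_ideal D f <-> kill_vars D f = 0.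
Proof.
split=> [[g ->]|f0]; last by rewrite -[f]subr0 -f0; exact: var_ideal_subkill.
rewrite /kill_vars rmorph_sum big1 //= => i iD.
by rewrite -/(kill_vars D _) kill_varsM kill_varsX iD mulr0.
Qed.

(** The kernel of a ring morphism into a domain is prime. *)
Lemma var_ideal_prime D : is_prime_ideal (var_ideal D).
Proof.
split.
- split; [exact: var_ideal0 | exact: var_idealD | exact: var_idealMl].
- by rewrite var_idealP /kill_vars rmorph1 => /eqP; rewrite oner_eq0.
- move=> f g; rewrite !var_idealP kill_varsM => /eqP.
  by rewrite mulf_eq0 => /orP[]/eqP; [left | right].
Qed.

Lemma var_ideal1P i f : var_ideal [set i] f <-> exists g, f = g * 'X_i.
Proof.
split=> [[g ->]|[g ->]]; first by exists (g i); rewrite big_set1.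
by exists (fun=> g); rewrite big_set1.
Qed.

Lemma var_ideal2P i j f : i != j ->
  var_ideal [set i; j] f <-> exists p q, f = p * 'X_i + q * 'X_j.
Proof.
move=> ij; have ijS : i \notin [set j] by rewrite inE.
split=> [[g ->]|[p [q ->]]].
  by exists (g i), (g j); rewrite big_setU1 //= big_set1.
exists (fun l => if l == i then p else q).
by rewrite big_setU1 //= big_set1 eqxx eq_sym (negPf ij).
Qed.

Lemma X_neq0 i : 'X_i != 0 :> R.
Proof.
apply/eqP => /(congr1 (mcoeff U_(i))) /eqP.
by rewrite mcoeffX eqxx mcoeff0 oner_eq0.
Qed.

Lemma cover_monomial_notin_var_ideal D C :
  [disjoint D & C] -> ~ var_ideal D (@cover_monomial K n C).
Proof.
move=> DC; rewrite var_idealP /kill_vars rmorph_prod /= => /eqP.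
apply/negP; apply/prodf_neq0 => i iC.
rewrite -/(kill_vars D _) kill_varsX (disjointFl DC iC); exact: X_neq0.
Qed.

(** The ideal of ['X_i] is prime and misses the monomial of [C]. This is the only divisibility
    argument used for syzygies and colons. *)
Lemma X_dvd_mull i f g C : i \notin C ->
  f * cover_monomial K C = g * 'X_i -> exists h, f = h * 'X_i.
Proof.
move=> iC fC; rewrite -var_ideal1P.
have [_ _ /(_ f (cover_monomial K C))[]] // := var_ideal_prime [set i].
  by apply/var_ideal1P; exists g.
by move/cover_monomial_notin_var_ideal; case; rewrite disjoints1.
Qed.

Lemma dhomog_cover_monomial C : cover_monomial K C \is #|C|.-homog.
Proof.
rewrite /cover_monomial -sum1_card; elim/big_ind2: _ => //.
- exact: dhomog1.
- by move=> ? ? ? ? *; exact: dhomogM.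
- by move=> i _; rewrite dhomogX /= mdeg1.
Qed.

Lemma cover_monomial_sub C D : C \subset D ->
  cover_monomial K D = cover_monomial K (D :\: C) * cover_monomial K C.
Proof.
by move=> /setIidPr CD; rewrite /cover_monomial (big_setID C) CD mulrC.
Qed.

Lemma cover_monomial_in_var_ideal D C i :
  i \in C -> i \in D -> var_ideal D (cover_monomial K C).
Proof.
move=> iC iD; rewrite (@cover_monomial_sub [set i]) ?sub1set //.
by rewrite [X in _ * X]big_set1; apply: var_idealMl; exact: var_idealX.
Qed.

(** * Cover ideals and homogeneity *)

Lemma is_ideal_sum I (T : finType) (P : pred T) (F : T -> R) :
  is_ideal I -> (forall t, P t -> I (F t)) -> I (\sum_(t | P t) F t).
Proof. by case=> I0 ID _ IF; elim/big_ind: _. Qed.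

Lemma cover_ideal_is_ideal (e : rel 'I_n) : is_ideal (@cover_ideal K n e).
Proof.
split=> [|f g [a ->] [b ->]|f g [b ->]].
- by exists (fun=> 0); rewrite big1 // => C _; rewrite mul0r.
- exists (fun C => a C + b C); rewrite -big_split.
  by apply: eq_bigr => C _; rewrite mulrDl.
- exists (fun C => f * b C); rewrite mulr_sumr.
  by apply: eq_bigr => C _; rewrite mulrA.
Qed.

(** A cover contains a minimal one, whose monomial divides that of [C]. *)
Lemma vertex_cover_in_cover_ideal (e : rel 'I_n) C :
  vertex_cover e C -> cover_ideal e (cover_monomial K C).
Proof.
move=> /minset_exists[D Dmin DC]; rewrite (cover_monomial_sub DC).
have [_ _] := cover_ideal_is_ideal e; apply.
exists (fun B => (B == D)%:R); rewrite (bigD1 D) //= eqxx mul1r.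
by rewrite big1 ?addr0 // => B /andP[_ /negPf->]; rewrite mul0r.
Qed.

Lemma dhomog0_const (f : R) : f \is 0.-homog -> exists c, f = c%:MP.
Proof.
move=> f0; exists f@_0%MM; apply/mpolyP => m; rewrite mcoeffC.
have [->|m0] := eqVneq m 0%MM; first by rewrite mulr1.
by rewrite mulr0 (dhomog_nemf_coeff f0) //= mdeg_eq0.
Qed.

Lemma homog_entryP s d t (p : R) :
  p \is d.-homog -> (d + s = t)%N -> homog_entry s t p.
Proof. by move=> /dhomogP hp <- m /hp->. Qed.

Lemma homog_entry0 s t : homog_entry s t (0 : R).
Proof. by move=> m; rewrite msupp0. Qed.

Lemma dhomog_coeff0 d (p : R) : p \is d.+1.-homog -> p@_0%MM = 0.
Proof. by move=> hp; rewrite (dhomog_nemf_coeff hp) //= mdeg0. Qed.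

End VariableIdeals.

(** * Syzygies and v-number of the ideal (za, zb, M) *)

Section HilbertBurch.
Variables (K : fieldType) (n : nat) (z a b : 'I_n) (S : {set 'I_n}).
Variable I : {mpoly K[n]} -> Prop.
Hypotheses (za : z != a) (zb : z != b) (ab : a != b).
Hypotheses (aS : a \in S) (bS : b \in S) (zS : z \notin S).
Local Notation R := {mpoly K[n]}.
Local Notation Z := ('X_z : R).
Local Notation A := ('X_a : R).
Local Notation B := ('X_b : R).
Local Notation M := (cover_monomial K S).
Local Notation N := (cover_monomial K (S :\ a)).
Hypothesis IP : forall f : R, I f <->
  exists p q r, f = p * (Z * A) + q * (Z * B) + r * M.

Let MNA : M = N * A.
Proof.
rewrite (@cover_monomial_sub _ _ [set a]) ?sub1set //.
by rewrite /cover_monomial big_set1.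
Qed.

Let cover_monomial1 i : cover_monomial K [set i] = 'X_i :> R.
Proof. exact: big_set1. Qed.

(** [Z] divides [r * M], hence [r]; after cancelling [Z], [A] divides [q * B], hence [q]; after
    cancelling [A], [p] is determined. *)
Lemma first_syzygies (p q r : R) :
  p * (Z * A) + q * (Z * B) + r * M = 0 ->
  exists s t, [/\ p = s * B + t * N, q = - (s * A) & r = - (t * Z)].
Proof.
move=> E; have [t rE] : exists t, r = t * Z.
  apply: (X_dvd_mull (g := - (p * A + q * B)) zS).
  by apply: (eq_of_sub E); ring.
subst r; have {E} : Z * (p * A + q * B + t * N * A) = 0 by rewrite -E MNA; ring.
move/eqP; rewrite mulf_eq0 (negPf (X_neq0 K z)) => /eqP E.
have [s qE] : exists s, q = s * A.
  apply: (X_dvd_mull (g := - (p + t * N)) (C := [set b])); first by rewrite inE.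
  by rewrite cover_monomial1; apply: (eq_of_sub E); ring.
subst q; have {E} : A * (p + s * B + t * N) = 0 by rewrite -E; ring.
move/eqP; rewrite mulf_eq0 (negPf (X_neq0 K a)) => /eqP E.
(* The quotients of [q] by [A] and of [r] by [Z] are the syzygy coordinates up to sign. *)
exists (- s), (- t); split; [|by ring|by ring].
by apply: (eq_of_sub E); ring.
Qed.

(** If [h * Z] is in [I], the coefficient of [M] is divisible by [Z]; cancelling [Z] leaves
    multiples of [A], [B] and [M], and [A] divides [M]. *)
Lemma colon_Z (h : R) : var_ideal [set a; b] h <-> colon I Z h.
Proof.
rewrite (var_ideal2P _ ab) /colon IP; split=> [[p [q ->]]|[p [q [r E]]]].
  by exists p, q, 0; ring.
have [t rE] : exists t, r = t * Z.
  apply: (X_dvd_mull (g := h - (p * A + q * B)) zS).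
  by apply: (eq_of_sub (esym E)); ring.
subst r; have {E} : Z * (h - (p * A + q * B + t * N * A)) = 0.
  by apply: (eq_of_sub E); rewrite MNA; ring.
move/eqP; rewrite mulf_eq0 (negPf (X_neq0 K z)) => /eqP E.
by exists (p + t * N), q; apply: (eq_of_sub E); ring.
Qed.

(** Such a [D] meets the support of each of the three generators. *)
Lemma I_sub_var_ideal (D : {set 'I_n}) (f : R) :
  (z \in D) || (a \in D) -> b \in D -> I f -> var_ideal D f.
Proof.
rewrite IP => zaD bD [p [q [r ->]]].
apply: var_idealD; [apply: var_idealD|]; apply: var_idealMl.
- case/orP: zaD => ?; last by apply: var_idealMl; exact: var_idealX.
  by rewrite mulrC; apply: var_idealMl; exact: var_idealX.
- by apply: var_idealMl; exact: var_idealX.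
- exact: (cover_monomial_in_var_ideal _ bS).
Qed.

(** Degree 1 is attained by [Z]. In degree 0, the colon by a constant is [R] or [I], and neither is
    a prime ideal. *)
Lemma v_number_one : is_v_number I 1.
Proof.
split=> [|[|//] [f [P [/dhomog0_const[c ->]] [Pprime _] colonP]]].
  exists Z, (var_ideal [set a; b]); split; first by rewrite dhomogX /= mdeg1.
    by split; [exact: var_ideal_prime | exists Z => h; exact: colon_Z].
  by move=> h; rewrite colon_Z.
have PI h : P h -> I h.
  (* For [c = 0] the colon contains 1, against properness of [P]; otherwise [c] is a unit and the
     colon is [I]. *)
  have [c0|c0] := eqVneq c 0.
    case: Pprime => _ /(_ _)[]; apply/colonP; rewrite /colon c0 mulr0 IP.
    by exists 0, 0, 0; ring.
  move/colonP; rewrite /colon !IP => -[p [q [r E]]].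
  exists (c^-1%:MP * p), (c^-1%:MP * q), (c^-1%:MP * r).
  rewrite -!mulrA -!mulrDr -E mulrCA -mpolyCM mulVf //.
  by rewrite mpolyC1 mulr1.
have PZA : P (Z * A).
  by apply/colonP; rewrite /colon IP; exists c%:MP, 0, 0; ring.
have notin (D : {set 'I_n}) i : i \notin D -> ~ var_ideal D ('X_i : R).
  rewrite -cover_monomial1 => iD; apply: cover_monomial_notin_var_ideal.
  by rewrite disjoint_sym disjoints1.
(* Neither factor of [Z * A] is in [I]: the prime (a, b) contains [I] but not [Z], and (z, b)
   contains [I] but not [A]. *)
case: Pprime => _ _ /(_ _ _ PZA)[/PI IX | /PI IX].
  case: (notin [set a; b] z); first by rewrite !inE negb_or za zb.
  by apply: I_sub_var_ideal IX; rewrite !inE eqxx ?orbT.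
case: (notin [set z; b] a); first by rewrite !inE negb_or eq_sym za ab.
by apply: I_sub_var_ideal IX; rewrite !inE eqxx ?orbT.
Qed.

(** * The Hilbert-Burch resolution *)

Definition hb_shifts (i : nat) : seq nat :=
  nth [::] [:: [:: 0]; [:: 2; 2; #|S|]; [:: 3; #|S|.+1]]%N i.

(** The 2-minors of the second matrix are the three generators up to sign. Beyond the lists, the
    default [[::]] encodes zero modules and maps. *)
Definition hb_matrix (i : nat) : seq (seq R) :=
  nth [::] [:: [:: [:: Z * A]; [:: Z * B]; [:: M]];
               [:: [:: B; - A; 0]; [:: N; 0; - Z]]] i.

Definition hb_complex : free_complex K n := @FreeComplex K n
  (fun i => size (hb_shifts i)) (fun i j => nth 0%N (hb_shifts i) j)
  (fun i => \matrix_(j, l) nth 0 (nth [::] (hb_matrix i) j) l) (const_mx 1).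

Lemma hb_rank_ge3 i : 'I_(rk hb_complex i.+3) -> False.
Proof. by case=> j; rewrite [rk _ _]/(size (nth _ _ _)) nth_default. Qed.

Let i0 : 'I_3 := inord 0.
Let i1 : 'I_3 := inord 1.
Let i2 : 'I_3 := inord 2.

Lemma sum3 (F : 'I_3 -> R) : \sum_i F i = F i0 + F i1 + F i2.
Proof.
rewrite !big_ord_recl big_ord0 addr0 addrA.
by congr (F _ + F _ + F _); apply: val_inj; rewrite /= inordK.
Qed.

Lemma ord3P (j : 'I_3) : [\/ j = i0, j = i1 | j = i2].
Proof.
case: j => [[|[|[|//]]] ?]; [constructor 1|constructor 2|constructor 3];
  by apply: val_inj; rewrite /= inordK.
Qed.

Lemma hb_aug (u : 'rV[R]_1) : (u *m aug hb_complex) 0 0 = u 0 0.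
Proof. by rewrite mxE big_ord1 mxE mulr1. Qed.

Lemma hb_diff0 (u : 'rV[R]_3) : (u *m diff hb_complex 0) 0 0 =
  u 0 i0 * (Z * A) + u 0 i1 * (Z * B) + u 0 i2 * M.
Proof. by rewrite mxE sum3 !mxE !inordK. Qed.

(** The coordinates have the shape given by [first_syzygies]; the case [v = 0] yields injectivity of
    the last map. *)
Lemma hb_diff1 (u : 'rV[R]_2) (v : 'rV[R]_3) : v = u *m diff hb_complex 1 <->
  [/\ v 0 i0 = u 0 0 * B + u 0 1 * N, v 0 i1 = - (u 0 0 * A)
    & v 0 i2 = - (u 0 1 * Z)].
Proof.
have E j : (u *m diff hb_complex 1) 0 j =
    u 0 0 * nth 0 [:: B; - A; 0] j + u 0 1 * nth 0 [:: N; 0; - Z] j.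
  rewrite mxE !big_ord_recl big_ord0 addr0 !mxE /=.
  by congr (_ * _ + u _ _ * _); apply: val_inj.
split=> [->|[v0 v1 v2]].
  by rewrite !E /i0 /i1 /i2 !inordK //=; split=> //; ring.
apply/rowP => j; rewrite E.
case: (ord3P j) => ->; rewrite ?v0 ?v1 ?v2 /i0 /i1 /i2 !inordK //=; ring.
Qed.

Lemma hb_complex_resolution : is_resolution I hb_complex.
Proof.
split.
- exists (const_mx 1); rewrite hb_aug mxE subrr IP.
  by exists 0, 0, 0; rewrite !mul0r !addr0.
- move=> u; rewrite hb_aug IP; split=> [[p [q [r E]]]|[w ->]]; last first.
    by rewrite hb_diff0; exists (w 0 i0), (w 0 i1), (w 0 i2).
  exists (\row_j nth 0 [:: p; q; r] j); apply/rowP => j.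
  by rewrite ord1 hb_diff0 !mxE !inordK.
- case=> [|[|i]] u.
  (* Exactness at F_1: kernel elements are described by [first_syzygies], and the converse uses
     [M = N * A]. *)
  + split=> [/rowP/(_ 0)|[w /hb_diff1[E0 E1 E2]]].
      rewrite hb_diff0 mxE => /first_syzygies[s [t [E0 E1 E2]]].
      exists (\row_j nth 0 [:: s; t] j); apply/hb_diff1.
      by rewrite E0 E1 E2 !mxE.
    apply/rowP => j; rewrite ord1 hb_diff0 E0 E1 E2 mxE MNA; ring.
  (* Injectivity on F_2: the last two coordinates of the image are multiples of [A] and [Z] in a
     domain. Conversely [w] has length 0. *)
  + split=> [/esym/hb_diff1|[w ->]]; last by rewrite [w]thinmx0 !mul0mx.
    rewrite !mxE => -[_ /esym/eqP uA /esym/eqP uZ].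
    exists 0; rewrite mul0mx; apply/rowP => j; rewrite mxE.
    move: uA uZ; rewrite !oppr_eq0 !mulf_eq0 !(negPf (X_neq0 _ _)) !orbF.
    move=> /eqP u0 /eqP u1.
    by case: j => [[|[|//]] jlt]; [rewrite -[RHS]u0|rewrite -[RHS]u1];
      congr (u _ _); apply: val_inj.
  + have -> : u = 0 by apply/rowP => j; case: (hb_rank_ge3 j).
    by rewrite mul0mx; split=> // _; exists 0; rewrite mul0mx.
Qed.

Let cardS_gt1 : (1 < #|S|)%N.
Proof. by apply/card_gt1P; exists a, b. Qed.

Let homX i : 'X_i \is [in K[n], 1.-homog].
Proof. by rewrite dhomogX /= mdeg1. Qed.

Let homXX i j : ('X_i * 'X_j : R) \is 2.-homog.
Proof. exact: (dhomogM (homX i) (homX j)). Qed.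

Let homM : M \is #|S|.-homog := dhomog_cover_monomial K S.

Let homN : N \is #|S|.-1.-homog.
Proof.
by have := dhomog_cover_monomial K (S :\ a); rewrite (cardsD1 a S) aS.
Qed.

(** In the second matrix, [B] and [- A] lead from shift 2 to 3, [N] from 2 to [#|S|.+1], and [- Z]
    from [#|S|] to [#|S|.+1]. *)
Lemma hb_complex_graded : is_graded hb_complex.
Proof.
split=> [j|[|[|i]] j l]; last by case: (hb_rank_ge3 j).
- by rewrite mxE ord1; exact: (@homog_entryP _ _ 0 0 0 1 (dhomog1 _ _)).
- rewrite mxE ord1 /=.
  case: (ord3P j) => ->; rewrite !inordK //=.
  + exact: (homog_entryP (homXX _ _)).
  + exact: (homog_entryP (homXX _ _)).
  + by apply: (homog_entryP homM); rewrite addn0.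
- rewrite mxE; case: j => [[|[|//]] ?]; case: (ord3P l) => ->;
    rewrite /= !inordK //=; try exact: homog_entry0.
  + exact: (homog_entryP (homX _)).
  + by apply: (@homog_entryP _ _ 2 1); rewrite ?dhomogN.
  + by apply: (homog_entryP homN); rewrite addn2 prednK // ltnW.
  + by apply: (@homog_entryP _ _ _ 1); rewrite ?dhomogN.
Qed.

Lemma hb_complex_minimal : is_minimal hb_complex.
Proof.
case=> [|[|i]] j l; last by case: (hb_rank_ge3 j).
- rewrite mxE ord1; case: (ord3P j) => ->; rewrite !inordK //=.
  + exact: (dhomog_coeff0 (homXX _ _)).
  + exact: (dhomog_coeff0 (homXX _ _)).
  + by apply: (@dhomog_coeff0 _ _ #|S|.-1); rewrite prednK // ltnW.
- rewrite mxE; case: j => [[|[|//]] ?]; case: (ord3P l) => ->;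
    rewrite !inordK //= ?mcoeff0 ?mcoeffN //.
  + exact: (dhomog_coeff0 (homX _)).
  + by rewrite (dhomog_coeff0 (homX _)) oppr0.
  (* [N] has degree [#|S|.-1], positive because [S] contains both [a] and [b]. *)
  + apply: (@dhomog_coeff0 _ _ #|S|.-2).
    by rewrite prednK // -ltnS prednK // ltnW.
  + by rewrite (dhomog_coeff0 (homX _)) oppr0.
Qed.

(** The differences of shift and homological degree are 0, then 1, 1, |S| - 1, then 1, |S| - 1; and
    |S| is at least 2. *)
Lemma regularity_pred_card : is_regularity I (#|S|.-1)%:Z.
Proof.
exists (fun i j => #|[set l : 'I_(rk hb_complex i) | sh l == j]|); split.
- exists hb_complex; split=> //; split.
  + exact: hb_complex_graded.
  + exact: hb_complex_resolution.
  + exact: hb_complex_minimal.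
(* The maximum is attained at the generator [M]. *)
- exists 1%N, #|S|; split; last by rewrite predn_int // ltnW.
  by rewrite -lt0n; apply/card_gt0P; exists i2; rewrite inE /= inordK.
- move=> i j; rewrite -lt0n => /card_gt0P[l]; rewrite inE => /eqP <-.
  case: i l => [|[|[|i]]] l; last by case: (hb_rank_ge3 l).
  all: case: l => [[|[|[|//]]]] //= _;
    case: #|S| cardS_gt1 => [|[|s]] // _; lia.
Qed.

End HilbertBurch.

(** * The coned graph and its cover ideal *)

Section ConedEdge.
Variables (K : fieldType) (k : nat).
Let z : 'I_k.+3 := inord 0.
Let a : 'I_k.+3 := inord 1.
Let b : 'I_k.+3 := inord 2.

(* Distinct i, j have i * j <= 2 iff one of them is 0 or {i, j} = {1, 2}. *)
Definition coned_edge : rel 'I_k.+3 := fun i j => (i != j) && (i * j <= 2)%N.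

Lemma coned_edge_simple : simple_graph coned_edge.
Proof.
by split=> [i j|i]; rewrite /coned_edge ?eqxx // eq_sym mulnC.
Qed.

Lemma coned_edge_connected : connected_graph coned_edge.
Proof.
have to_z i : connect coned_edge i z.
  have [->|iz] := eqVneq i z; first exact: connect0.
  by apply: connect1; rewrite /coned_edge iz inordK // muln0.
have from_z i : connect coned_edge z i.
  have [->|iz] := eqVneq i z; first exact: connect0.
  by apply: connect1; rewrite /coned_edge eq_sym iz inordK // mul0n.
by split=> // i j; exact: connect_trans (to_z i) (from_z j).
Qed.

(** A cover containing [z] needs [a] or [b] for the edge ab; one missing [z] must contain all
    neighbours of [z], that is, all other vertices. *)
Lemma coned_edge_vertex_cover (C : {set 'I_k.+3}) :
  vertex_cover coned_edge C <->
  [\/ [set z; a] \subset C, [set z; b] \subset C | ~: [set z] \subset C].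
Proof.
have coverP : reflect
    (forall i j, coned_edge i j -> (i \in C) || (j \in C))
    (vertex_cover coned_edge C).
  by apply: (iffP forallP) => [H i j|H i];
    [exact: (implyP (forallP (H i) j)) | apply/forallP => j; apply/implyP/H].
have eq_ord (i : 'I_k.+3) m : (m < k.+3)%N -> (i == inord m) = (i == m :> nat).
  by move=> mk; rewrite -val_eqE /= inordK.
split=> [/coverP cov|H].
  have [zC|zC] := boolP (z \in C); last first.
    apply: Or33; apply/subsetP => i; rewrite !inE => iz.
    have ez : coned_edge i z by rewrite /coned_edge iz inordK // muln0.
    by have := cov _ _ ez; rewrite (negPf zC) orbF.
  have eab : coned_edge a b by rewrite /coned_edge eq_ord // !inordK.
  have [aC|bC] := orP (cov _ _ eab).
    by apply: Or31; rewrite subUset !sub1set zC.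
  by apply: Or32; rewrite subUset !sub1set zC.
apply/coverP => i j /andP[]; rewrite -[i == j]/(i == j :> nat) => ij ij2.
apply/norP => -[iC jC].
have notin (D : {set 'I_k.+3}) l : D \subset C -> l \notin C -> l \notin D.
  by move=> /subsetP DC; apply/contra/DC.
(* The ends of an uncovered edge avoid {0, 1} or {0, 2}, so, being distinct, have product above 2;
   or both equal [z], which is absurd. *)
case: H => DC; have := notin _ _ DC jC; have := notin _ _ DC iC;
  move: ij ij2; rewrite !inE !eq_ord //.
- by case: (i : nat) (j : nat) => [|[|i']] [|[|j']] //; nia.
- by case: (i : nat) (j : nat) => [|[|[|i']]] [|[|[|j']]] //; nia.
- by rewrite !negbK => /eqP ij' _ /eqP i0 /eqP j0; case: ij'; rewrite i0.
Qed.

Let S : {set 'I_k.+3} := ~: [set z].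

Lemma coned_edge_cover_ideal (f : {mpoly K[k.+3]}) :
  cover_ideal coned_edge f <-> exists p q r,
    f = p * ('X_z * 'X_a) + q * ('X_z * 'X_b) + r * cover_monomial K S.
Proof.
have pairE c : z != c -> cover_monomial K [set z; c] = 'X_z * 'X_c.
  by move=> zc; rewrite /cover_monomial big_setU1 ?inE //= big_set1.
have za : z != a by rewrite -val_eqE /= !inordK.
have zb : z != b by rewrite -val_eqE /= !inordK.
have [J0 JD JM] := cover_ideal_is_ideal K coned_edge.
have JC (C : {set 'I_k.+3}) :
    [\/ [set z; a] \subset C, [set z; b] \subset C | S \subset C] ->
    cover_ideal coned_edge (cover_monomial K C).
  by move=> ?; apply: vertex_cover_in_cover_ideal; apply/coned_edge_vertex_cover.
split=> [[g ->]|[p [q [r ->]]]]; last first.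
  rewrite -!pairE //; apply: (JD); [apply: (JD)|]; apply/JM/JC.
  - by apply: Or31.
  - by apply: Or32.
  - by apply: Or33.
(* The right-hand side is an ideal, so it suffices that each minimal cover contains one of the three
   sets and its monomial is a multiple of that generator. *)
pose I f := exists p q r : {mpoly K[k.+3]},
  f = p * ('X_z * 'X_a) + q * ('X_z * 'X_b) + r * cover_monomial K S.
have I_ideal : is_ideal I.
  split=> [|_ _ [p [q [r ->]]] [p' [q' [r' ->]]]|h _ [p [q [r ->]]]].
  - by exists 0, 0, 0; ring.
  - by exists (p + p'), (q + q'), (r + r'); ring.
  - by exists (h * p), (h * q), (h * r); ring.
apply: (is_ideal_sum I_ideal) => C /minsetp/coned_edge_vertex_cover HC.
have [_ _ IM] := I_ideal; apply: (IM).
case: HC => /cover_monomial_sub->; apply: (IM).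
- by exists 1, 0, 0; rewrite pairE //; ring.
- by exists 0, 1, 0; rewrite pairE //; ring.
- by exists 0, 0, 1; ring.
Qed.

(** Here [S] has k + 2 elements, so the regularity |S| - 1 is k + 1. *)
Lemma coned_edge_invariants :
  is_regularity (@cover_ideal K k.+3 coned_edge) k.+1%:Z /\
  is_v_number (@cover_ideal K k.+3 coned_edge) 1.
Proof.
have za : z != a by rewrite -val_eqE /= !inordK.
have zb : z != b by rewrite -val_eqE /= !inordK.
have ab : a != b by rewrite -val_eqE /= !inordK.
have aS : a \in S by rewrite !inE eq_sym.
have bS : b \in S by rewrite !inE eq_sym.
have zS : z \notin S by rewrite !inE eqxx.
have cardS : #|S|.-1 = k.+1 by rewrite cardsC1 card_ord.
split; last exact: (v_number_one za zb ab aS bS zS coned_edge_cover_ideal).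
have := regularity_pred_card ab aS bS zS coned_edge_cover_ideal.
by rewrite cardS.
Qed.

End ConedEdge.

Theorem theorem3p10 (K : fieldType) (k : nat) (hk : (0 < k)%N) :
  exists (n : nat) (e : rel 'I_n),
    [/\ simple_graph e, connected_graph e &
        exists (r : int) (v : nat),
          [/\ is_regularity (@cover_ideal K n e) r,
              is_v_number (@cover_ideal K n e) v &
              r - v%:Z = k%:Z]].
Proof.
exists k.+3, (@coned_edge k); split.
- exact: coned_edge_simple.
- exact: coned_edge_connected.
- have [reg v1] := coned_edge_invariants K k.
  by exists k.+1%:Z, 1%N; split=> //; rewrite -predn_int.
Qed.
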